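(* Let $D=p_1(x_1,x_2)\partial_{x_1}+p_2(x_1,x_2)\partial_{x_2}$ be a simple derivation of $K[x_1,x_2]$, where $p_1,p_2\in K[x_1,x_2]$. Suppose that for every $f\in\operatorname{Aut}(K[x_1,x_2])_D$ one has $f-f(0)\in\operatorname{Aut}(K[x_1,x_2])_D$. Then $\operatorname{Aut}(K[x_1,x_2])_D=\{\mathrm{id}\}$.
   Context: $K$ is a field of characteristic zero and $\partial_{x_i}=\partial/\partial x_i$. A $K$-derivation $D$ of $K[x_1,x_2]$ is a $K$-linear map with $D(ab)=D(a)b+aD(b)$. An ideal $I$ is $D$-stable if $D(I)\subset I$; $D$ is simple if the only $D$-stable ideals of $K[x_1,x_2]$ are $0$ and $K[x_1,x_2]$. Invertible polynomial maps $f=(f_1,f_2)$ (polynomial maps $K^2\to K^2$ with a polynomial inverse) are identified with $K$-automorphisms $\rho$ of $K[x_1,x_2]$ via $\rho(g)=g(f_1,f_2)$, i.e. $\rho(x_i)=f_i$. $\operatorname{Aut}(K[x_1,x_2])$ is the group of $K$-automorphisms of $K[x_1,x_2]$ and $\operatorname{Aut}(K[x_1,x_2])_D=\{\rho\in\operatorname{Aut}(K[x_1,x_2]) : \rho D=D\rho\}$. Write $f(0)=(f_1(0,0),f_2(0,0))\in K^2$ and $f-f(0)=(f_1-f_1(0,0),f_2-f_2(0,0))$. *)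

(* Defs.v *)
From HB Require Import structures.
From mathcomp Require Import all_boot all_order all_algebra.
From mathcomp Require Export mpoly.

Set Implicit Arguments.
Unset Strict Implicit.
Unset Printing Implicit Defensive.

Import GRing.Theory.
Local Open Scope ring_scope.

(* The indices 0 and 1 of 'I_2 stand for the variables x_1 and x_2. *)
Definition i1 : 'I_2 := ord0.
Definition i2 : 'I_2 := ord_max.

Section Defs.
Variable K : fieldType.
Notation P := {mpoly K[2]}.

Definition derivation (D : P -> P) : Prop :=
  linear D /\ (forall a b : P, D (a * b) = D a * b + a * D b).

Definition vector_field (p1 p2 : P) : P -> P :=
  fun g => p1 * g^`M(i1) + p2 * g^`M(i2).

Definition ideal (I : P -> Prop) : Prop :=
  [/\ I 0,
      (forall a b : P, I a -> I b -> I (a + b)) &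
      (forall c a : P, I a -> I (c * a))].

Definition stable (D : P -> P) (I : P -> Prop) : Prop :=
  forall g : P, I g -> I (D g).

Definition simple_derivation (D : P -> P) : Prop :=
  derivation D /\
  (forall I : P -> Prop, ideal I -> stable D I ->
     (forall g : P, I g <-> g = 0) \/ (forall g : P, I g)).

Definition in_Aut_D (D : P -> P) (rho : {lrmorphism P -> P}) : Prop :=
  bijective rho /\ (forall g : P, rho (D g) = D (rho g)).

(* A polynomial map K^2 -> K^2 is the pair of its components.  It corresponds
   to the K-algebra endomorphism g |-> g(f_1, f_2), from which it is recovered
   as the pair of images of the variables. *)
Definition polymap : Type := 2.-tuple P.

Definition endo_of_map (f : polymap) : {lrmorphism P -> P} := comp_mpoly f.

Definition map_of_endo (rho : {lrmorphism P -> P}) : polymap :=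
  [tuple rho 'X_i | i < 2].

Lemma map_of_endoK (rho : {lrmorphism P -> P}) :
  endo_of_map (map_of_endo rho) =1 rho.
Proof.
move=> g; rewrite /= comp_mpolyEX [in RHS](mpolyE g) raddf_sum /=.
apply: eq_bigr => m _; rewrite linearZ; congr (_ *: _).
rewrite comp_mpolyX mpolyXE_id rmorph_prod; apply: eq_bigr => i _.
by rewrite rmorphXn tnth_mktuple.
Qed.

(* f - f(0) *)
Definition sub_origin (f : polymap) : polymap :=
  [tuple tnth f i - (tnth f i).@[fun=> 0]%:MP | i < 2].

End Defs.

(* Main.v *)
Require Import Defs.
From mathcomp Require Import all_boot all_order all_algebra.
From mathcomp Require Import ring.

Set Implicit Arguments.
Unset Strict Implicit.
Unset Printing Implicit Defensive.

Import GRing.Theory.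
Local Open Scope ring_scope.

(** Let D be simple and rho an automorphism commuting with D.

    If rho fixes a point a of the plane, then rho = id.  Indeed the
    polynomials g all of whose iterated derivatives D^k g vanish at a form a
    D-stable ideal, which does not contain 1 and hence is 0; and every
    rho(g) - g lies in it, since D^k (rho(g) - g) = rho(D^k g) - D^k g
    ([simple_commuting_fixed_point]).

    By hypothesis f - f(0), which fixes the origin, commutes with D, so it is
    the identity and f is a translation x |-> x + c.  It remains to see that
    c = 0.  Commutation with D says that the coefficients p1, p2 of D are
    invariant under the translation; in characteristic zero they are then
    killed by the constant vector field E = c1 d/dx1 + c2 d/dx2, because a
    polynomial in t that takes the same value at all natural numbers is
    constant ([translation_invariant_directional_derivative]).

    Suppose c <> 0 and put q = D(c2 x1 - c1 x2) = c2 p1 - c1 p2.  From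
    E p1 = E p2 = 0 one computes that q divides D q, so that the ideal (q) is
    D-stable and q is a constant ([simple_darboux_const]).  Since
    c1 div D = - dq/dx2 and c2 div D = dq/dx1, the divergence of D is zero.
    By the Poincare lemma D is the Hamiltonian field of some h, and D h = 0
    forces h to be a constant, that is D = 0, which is not simple
    ([simple_divergence_neq0]). *)

(** * Polynomial algebras *)

(** For statements compatible with sums and products, such as the chain rule or
    the equality of two ring morphisms, this spares an analysis of monomials. *)
Lemma mpoly_alg_ind (n : nat) (R : fieldType) (Q : {mpoly R[n]} -> Prop) :
  (forall c, Q c%:MP) -> (forall i, Q 'X_i) ->
  (forall p q, Q p -> Q q -> Q (p + q)) ->
  (forall p q, Q p -> Q q -> Q (p * q)) ->
  forall p, Q p.
Proof.
move=> QC QX QD QM p; rewrite [p]mpolyE.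
have Q0 : Q 0 by rewrite -(@mpolyC0 n R); exact: QC.
have Q1 : Q 1 by rewrite -(@mpolyC1 n R); exact: QC.
apply: big_ind => // m _; rewrite -mul_mpolyC; apply: (QM) => //.
rewrite mpolyXE_id; apply: big_ind => // i _.
by elim: (m i) => [|k IHk]; rewrite ?expr0 ?exprS //; apply: (QM).
Qed.

Lemma lrmorph_mpolyC (n : nat) (R : fieldType)
    (f : {lrmorphism {mpoly R[n]} -> {mpoly R[n]}}) (a : R) :
  f a%:MP = a%:MP.
Proof. by rewrite -[a%:MP]mulr1 mul_mpolyC linearZ rmorph1. Qed.

Lemma mderivXU (n : nat) (R : fieldType) (i j : 'I_n) :
  ('X_j : {mpoly R[n]})^`M(i) = (j == i)%:R.
Proof.
rewrite mderivX mnm1E; case: eqVneq => [->|_]; last by rewrite scale0r.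
have -> : (U_(i) - U_(i))%MM = 0%MM :> 'X_{1..n}.
  by apply/mnmP=> k; rewrite mnmBE subnn mnm0E.
by rewrite mpolyX0 scale1r.
Qed.

(** * Translation-invariant polynomials *)

Section Translation.

Variables (n : nat) (K : fieldType) (c : 'I_n -> K).
Hypothesis charK0 : [pchar K] =i pred0.
Notation P := {mpoly K[n]}.

Fact line_key : unit. Proof. by []. Qed.

(** [line p] is p(x + t c), as a polynomial in t over the ring of polynomials
    in x.  It is locked because conversion would otherwise compare [line p] with
    [line q] by unfolding both evaluations. *)
Definition line : P -> {poly P} :=
  locked_with line_key
    (mmap (polyC \o @mpolyC n K)
          (fun i => ('X_i : P)%:P + ((c i)%:MP : P)%:P * 'X)).

Lemma lineC a : line a%:MP = (a%:MP)%:P.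
Proof. by rewrite /line unlock; exact: mmapC. Qed.

Lemma lineX i : line 'X_i = ('X_i)%:P + ((c i)%:MP)%:P * 'X.
Proof. by rewrite /line unlock mmapX mmap1U. Qed.

Lemma lineD p q : line (p + q) = line p + line q.
Proof. by rewrite /line unlock; exact: mmapD. Qed.

Lemma lineM p q : line (p * q) = line p * line q.
Proof. by rewrite /line unlock; exact: (rmorphM (mmap _ _)). Qed.

Lemma line0 (p : P) : (line p).[0] = p.
Proof.
elim/mpoly_alg_ind: p => [a|i|p q IHp IHq|p q IHp IHq].
- by rewrite lineC hornerC.
- by rewrite lineX !hornerE.
- by rewrite lineD hornerD; congr (_ + _).
- by rewrite lineM hornerM; congr (_ * _).
Qed.

(** The chain rule. *)
Lemma line_deriv (p : P) :
  (line p)^`() = \sum_(i < n) ((c i)%:MP)%:P * line p^`M(i).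
Proof.
elim/mpoly_alg_ind: p => [a|i|p q IHp IHq|p q IHp IHq].
- rewrite lineC derivC big1 // => i _.
  by rewrite mderivC -(@mpolyC0 n K) lineC mpolyC0 mulr0.
- rewrite lineX derivD derivC add0r derivM derivC derivX.
  rewrite mul0r add0r mulr1.
  rewrite (bigD1 i) //= big1 => [|j neq_ji].
    by rewrite mderivXU eqxx -mpolyC_nat lineC mpolyC1 mulr1 addr0.
  by rewrite mderivXU eq_sym (negPf neq_ji) -mpolyC_nat lineC mpolyC0 mulr0.
- rewrite lineD derivD IHp IHq -big_split; apply: eq_bigr => i _ /=.
  by rewrite mderivD lineD mulrDr.
- rewrite lineM derivM IHp IHq mulr_suml mulr_sumr -big_split.
  apply: eq_bigr => i _ /=.
  by rewrite mderivM lineD !lineM mulrDr !mulrA [_ * line p]mulrC.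
Qed.

Variable tau : {lrmorphism P -> P}.
Hypothesis tauX : forall i, tau 'X_i = 'X_i + (c i)%:MP.

(** One unit of time along the line is one application of the translation. *)
Lemma line_natS (p : P) (k : nat) :
  (line p).[k.+1%:R] = tau (line p).[k%:R].
Proof.
elim/mpoly_alg_ind: p => [a|i|p q IHp IHq|p q IHp IHq].
- by rewrite lineC !hornerC lrmorph_mpolyC.
- rewrite lineX !hornerD !hornerC !hornerCM !hornerX.
  rewrite raddfD /= rmorphM /= rmorph_nat tauX lrmorph_mpolyC.
  by rewrite -natr1 mulrDr mulr1 -addrA [_ + (c i)%:MP]addrC.
- by rewrite lineD !hornerD raddfD /= IHp IHq.
- by rewrite lineM !hornerM rmorphM /= IHp IHq.
Qed.

Lemma natr_mpoly_inj : injective (fun k : nat => k%:R : P).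
Proof.
have natr_inj k : ((k%:R : K) == 0) = (k == 0%N) := (pcharf0P K).1 charK0 k.
suff le k l : k%:R = l%:R :> P -> (k <= l)%N.
  by move=> k l eqkl; apply/eqP; rewrite eqn_leq !le.
move=> eqkl; case: leqP => // ltlk; move: (subn_gt0 l k).
rewrite ltlk lt0n -natr_inj -(mpolyC_eq0 n) natrB ?(ltnW ltlk) //.
by rewrite raddfB /= !mpolyC_nat eqkl subrr eqxx.
Qed.

(** Along each line in the direction c the polynomial takes the value p at all
    natural times, hence is constant, and its derivative at time 0 is the
    left-hand side below. *)
Lemma translation_invariant_directional_derivative (p : P) :
  tau p = p -> \sum_(i < n) (c i)%:MP * p^`M(i) = 0.
Proof.
move=> tau_p.
have line_nat k : (line p).[k%:R] = p.
  by elim: k => [|k IHk]; rewrite ?line0 // line_natS IHk.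
have line_const : line p = p%:P.
  apply/eqP; rewrite -subr_eq0; apply/negP => /negP ne0.
  set F := _ - _ in ne0.
  have := @max_poly_roots _ F [seq k%:R | k <- iota 0 (size F)] ne0.
  rewrite size_map size_iota ltnn => H; apply: (notF (H _ _)).
    by apply/allP => _ /mapP[k _ ->]; rewrite rootE !hornerE line_nat subrr.
  by rewrite map_inj_uniq ?iota_uniq //; exact: natr_mpoly_inj.
have := line_deriv p; rewrite line_const derivC => /(congr1 (horner^~ 0)).
rewrite horner0 horner_sum => sum0; rewrite [RHS]sum0; apply: eq_bigr => i _.
by rewrite hornerM hornerC line0.
Qed.

End Translation.

(** * Hamiltonian vector fields *)

(** The term-by-term antiderivative with respect to one variable does not
    introduce variables that do not occur in g: this is what allows to
    integrate in several variables successively. *)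
Lemma mpoly_antiderivative (n : nat) (K : fieldType) (i : 'I_n)
    (g : {mpoly K[n]}) : [pchar K] =i pred0 ->
  exists A : {mpoly K[n]}, A^`M(i) = g /\
    forall j, j != i -> g^`M(j) = 0 -> A^`M(j) = 0.
Proof.
move=> charK0.
have nat_neq0 k : k.+1%:R != 0 :> K by rewrite ((pcharf0P K).1 charK0).
exists (\sum_(m <- msupp g) (g@_m / (m i).+1%:R) *: 'X_[m + U_(i)]).
split=> [|j neq_ji g_j0].
  rewrite linear_sum [RHS]mpolyE; apply: eq_bigr => m _ /=.
  rewrite mderivZ mderivX scalerA mnmDE mnm1E eqxx addn1 divfK //.
  by rewrite addmK.
rewrite linear_sum big_seq big1 // => m m_g /=.
rewrite mderivZ mderivX mnmDE mnm1E eq_sym (negPf neq_ji) addn0.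
case def_mj: (m j) => [|k]; first by rewrite scale0r scaler0.
have: g^`M(j)@_(m - U_(j)) = 0 by rewrite g_j0 mcoeff0.
rewrite mcoeff_mderiv submK; last first.
  by apply/mnm_lepP => l; rewrite mnm1E; case: eqP => // <-; rewrite def_mj.
move/eqP; rewrite -[_ *+ _]mulr_natr mulf_eq0 (negPf (nat_neq0 _)) orbF => /eqP->.
by rewrite mul0r scale0r.
Qed.

(** The Poincare lemma in the plane: with A an antiderivative of p1 in x2, the
    polynomial dA/dx1 + p2 does not involve x2, so it has an antiderivative B
    in x1 alone, and h = A - B. *)
Lemma divergence_free_hamiltonian (K : fieldType) (p1 p2 : {mpoly K[2]}) :
  [pchar K] =i pred0 -> p1^`M(i1) + p2^`M(i2) = 0 ->
  exists h : {mpoly K[2]}, h^`M(i2) = p1 /\ h^`M(i1) = - p2.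
Proof.
move=> charK0 div0.
have [A [A2 _]] := mpoly_antiderivative i2 p1 charK0.
have [B [B1 B_const]] := mpoly_antiderivative i1 (A^`M(i1) + p2) charK0.
have B2 : B^`M(i2) = 0.
  by apply: B_const => //; rewrite mderivD mderiv_comm A2.
exists (A - B); rewrite !mderivB A2 B2 B1 subr0; split=> //; ring.
Qed.

(** * Simple derivations of the plane *)

Section Simple.

Variable K : fieldType.
Notation P := {mpoly K[2]}.
Implicit Types (D : P -> P) (g q : P).

(** Vanishing of all D^k g at a is a property of g closed under multiplication
    by arbitrary polynomials, by the Leibniz rule, and under D. *)
Lemma simple_taylor_inj D (a : 'I_2 -> K) g :
  simple_derivation D -> (forall k, (iter k D g).@[a] = 0) -> g = 0.
Proof.
move=> [[linD leibnizD] simpleD] taylor_g0.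
have addD u v : D (u + v) = D u + D v.
  by have := linD 1 u v; rewrite !scale1r.
have zeroD : D 0 = 0.
  by apply: (addrI (D 0)); rewrite -addD !addr0.
have iter0 k : iter k D 0 = 0 by elim: k => //= k ->.
have iterD k u v : iter k D (u + v) = iter k D u + iter k D v.
  by elim: k => //= k ->.
pose I u := forall k, (iter k D u).@[a] = 0.
have idealI : ideal I.
  split=> [k|u v Iu Iv k|c u Iu k]; first by rewrite iter0 meval0.
    by rewrite iterD mevalD Iu Iv addr0.
  elim: k c u Iu => [|k IHk] c u Iu.
    by rewrite /= mevalM [u.@[a]](Iu 0%N) mulr0.
  rewrite iterSr leibnizD iterD mevalD !IHk ?addr0 // => l.
  by rewrite -iterSr Iu.
have stableI : stable D I by move=> u Iu k; rewrite -iterSr Iu.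
case: (simpleD I idealI stableI) => [I0|IT]; first by apply/I0.
by have := IT 1 0%N; rewrite /= meval1 => /eqP; rewrite oner_eq0.
Qed.

(** If rho fixes the point a, then rho g and g have the same value at a; as
    rho commutes with D, the same holds for all their iterated derivatives. *)
Lemma simple_commuting_fixed_point D (rho : {lrmorphism P -> P}) (a : 'I_2 -> K) :
  simple_derivation D -> (forall g, rho (D g) = D (rho g)) ->
  (forall i, (rho 'X_i).@[a] = a i) -> forall g, rho g = g.
Proof.
move=> simpleD commD fix_a g; apply/eqP; rewrite -subr_eq0; apply/eqP.
have eval_rho u : (rho u).@[a] = u.@[a].
  elim/mpoly_alg_ind: u => [b|i|u v IHu IHv|u v IHu IHv].
  - by rewrite lrmorph_mpolyC.
  - by rewrite fix_a mevalXU.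
  - by rewrite raddfD /= !mevalD IHu IHv.
  - by rewrite rmorphM /= !mevalM IHu IHv.
apply: (simple_taylor_inj (a := a) simpleD) => // k.
have [[linD _] _] := simpleD.
have -> : iter k D (rho g - g) = rho (iter k D g) - iter k D g.
  elim: k => //= k ->; rewrite commD addrC -scaleN1r linD scaleN1r.
  by rewrite addrC.
by rewrite mevalB eval_rho subrr.
Qed.

(** The ideal (q) is D-stable, so q is zero or a unit. *)
Lemma simple_darboux_const D q s :
  simple_derivation D -> D q = s * q -> exists k, q = k%:MP.
Proof.
move=> [[_ leibnizD] simpleD] Dq.
pose I u := exists v, u = v * q.
have idealI : ideal I.
  split=> [|_ _ [v ->] [w ->]|c _ [v ->]]; first by exists 0; rewrite mul0r.
    by exists (v + w); rewrite mulrDl.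
  by exists (c * v); rewrite mulrA.
have stableI : stable D I.
  by move=> _ [v ->]; exists (D v + v * s); rewrite leibnizD Dq mulrDl mulrA.
case: (simpleD I idealI stableI) => [I0|IT].
  by exists 0; rewrite mpolyC0; apply/I0; exists 1; rewrite mul1r.
have [v /esym vq1] := IT 1.
by exists q@_0; apply/eqP; case/andP: (mpoly_intro_unit vq1).
Qed.

(** A divergence-free field kills its Hamiltonian, which is therefore constant;
    then the field is zero, and even the variables would have to be constant. *)
Lemma simple_divergence_neq0 (p1 p2 : P) : [pchar K] =i pred0 ->
  simple_derivation (vector_field p1 p2) -> p1^`M(i1) + p2^`M(i2) != 0.
Proof.
move=> charK0 simpleD; apply/eqP => div0.
have [h [h2 h1]] := divergence_free_hamiltonian charK0 div0.
have Dh : vector_field p1 p2 h = 0 * h.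
  by rewrite /vector_field h1 h2; ring.
have [k def_h] := simple_darboux_const simpleD Dh.
have p1_0 : p1 = 0 by rewrite -h2 def_h mderivC.
have p2_0 : p2 = 0 by rewrite -[p2]opprK -h1 def_h mderivC oppr0.
have DX : vector_field p1 p2 'X_i1 = 0 * 'X_i1.
  by rewrite /vector_field p1_0 p2_0; ring.
have [l /(congr1 (mcoeff U_(i1)))] := simple_darboux_const simpleD DX.
rewrite mcoeffXU mcoeffC eqxx mnm1_eq0 mulr0 => /eqP.
by rewrite oner_eq0.
Qed.

(** Let q = c2 p1 - c1 p2, the image under D of the linear form c2 x1 - c1 x2,
    which is constant in the direction c.  Both c1 D q and c2 D q are multiples
    of q, and c1 div D and c2 div D are first derivatives of q up to sign.  So
    if some c_i is nonzero, q is a Darboux polynomial, hence a constant, and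
    div D = 0. *)
Lemma simple_no_invariant_direction (p1 p2 : P) (c : 'I_2 -> K) :
  [pchar K] =i pred0 -> simple_derivation (vector_field p1 p2) ->
  vector_field (c i1)%:MP (c i2)%:MP p1 = 0 ->
  vector_field (c i1)%:MP (c i2)%:MP p2 = 0 ->
  forall i, c i = 0.
Proof.
move=> charK0 simpleD Ep1 Ep2.
set c1 := (c i1)%:MP in Ep1 Ep2 *; set c2 := (c i2)%:MP in Ep1 Ep2 *.
pose q := c2 * p1 - c1 * p2.
have q_d i : q^`M(i) = c2 * p1^`M(i) - c1 * p2^`M(i).
  by rewrite mderivB !mderiv_mulC.
pose E := vector_field c1 c2.
have D1 : c1 * vector_field p1 p2 q = - q^`M(i2) * q.
  transitivity (- q^`M(i2) * q + p1 * (c2 * E p1 - c1 * E p2)).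
    by rewrite /E /vector_field !q_d /q; ring.
  by rewrite /E Ep1 Ep2 !mulr0 subrr mulr0 addr0.
have D2 : c2 * vector_field p1 p2 q = q^`M(i1) * q.
  transitivity (q^`M(i1) * q + p2 * (c2 * E p1 - c1 * E p2)).
    by rewrite /E /vector_field !q_d /q; ring.
  by rewrite /E Ep1 Ep2 !mulr0 subrr mulr0 addr0.
have div1 : c1 * (p1^`M(i1) + p2^`M(i2)) = - q^`M(i2).
  transitivity (- q^`M(i2) + E p1); first by rewrite q_d /E /vector_field; ring.
  by rewrite /E Ep1 addr0.
have div2 : c2 * (p1^`M(i1) + p2^`M(i2)) = q^`M(i1).
  transitivity (q^`M(i1) + E p2); first by rewrite q_d /E /vector_field; ring.
  by rewrite /E Ep2 addr0.
have div_neq0 := simple_divergence_neq0 charK0 simpleD.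
(* Here w is, up to sign, a derivative of q: it vanishes if q is constant. *)
have no_c i (w : P) (s : P) :
    (c i)%:MP * vector_field p1 p2 q = s * q ->
    (c i)%:MP * (p1^`M(i1) + p2^`M(i2)) = w ->
    ((exists k, q = k%:MP) -> w = 0) -> c i = 0.
  move=> Dq divw w0; apply/eqP; apply/negP => /negP ci_neq0.
  have /w0 w_eq0 : exists k, q = k%:MP.
    apply: (simple_darboux_const (s := (c i)^-1%:MP * s) simpleD).
    by rewrite -mulrA -Dq mulrA -mpolyCM mulVf // mpolyC1 mul1r.
  move/eqP: divw; rewrite w_eq0 mulf_eq0 (negPf div_neq0) orbF mpolyC_eq0.
  by rewrite (negPf ci_neq0).
have c1_0 : c i1 = 0.
  by apply: no_c D1 div1 _ => -[k ->]; rewrite mderivC oppr0.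
have c2_0 : c i2 = 0 by apply: no_c D2 div2 _ => -[k ->]; rewrite mderivC.
move=> i; case: (unliftP ord0 i) => [j ->|->]; last exact: c1_0.
by rewrite (ord1 j) -c2_0; congr c; apply/val_inj.
Qed.

End Simple.

Theorem corollary2p8 (K : fieldType) (charK0 : [pchar K] =i pred0)
    (p1 p2 : {mpoly K[2]}) :
  let D := vector_field p1 p2 in
  simple_derivation D ->
  (forall rho : {lrmorphism {mpoly K[2]} -> {mpoly K[2]}},
     in_Aut_D D rho ->
     in_Aut_D D (endo_of_map (sub_origin (map_of_endo rho)))) ->
  forall rho : {lrmorphism {mpoly K[2]} -> {mpoly K[2]}},
    in_Aut_D D rho <-> (forall g : {mpoly K[2]}, rho g = g).
Proof.
move=> D simpleD sub_origin_stable rho; split=> [rhoD|rho_id]; last first.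
  split; last by move=> g; rewrite !rho_id.
  by exists id => g; rewrite rho_id.
have [_ sub_comm] := sub_origin_stable rho rhoD.
set sub_rho := endo_of_map _ in sub_comm.
have [_ rho_comm] := rhoD.
pose c i := (rho 'X_i).@[fun=> 0].
have subX i : sub_rho 'X_i = rho 'X_i - (c i)%:MP.
  by rewrite /sub_rho /= comp_mpolyXU -tnth_nth !tnth_mktuple.
(* f - f(0) fixes the origin, so it is the identity: rho is a translation. *)
have rhoX i : rho 'X_i = 'X_i + (c i)%:MP.
  apply/eqP; rewrite -subr_eq -subX; apply/eqP.
  apply: (simple_commuting_fixed_point simpleD sub_comm (a := fun=> 0)) => j.
  by rewrite subX mevalB mevalC subrr.
have DX1 : D 'X_i1 = p1.
  by rewrite /D /vector_field !mderivXU /= mulr1 mulr0 addr0.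
have DX2 : D 'X_i2 = p2.
  by rewrite /D /vector_field !mderivXU /= mulr1 mulr0 add0r.
have D_shift i : D ('X_i + (c i)%:MP) = D 'X_i.
  by rewrite /D /vector_field !mderivD !mderivC !addr0.
have Ep_eq0 p : rho p = p -> vector_field (c i1)%:MP (c i2)%:MP p = 0.
  move=> rho_p; rewrite /vector_field.
  have := translation_invariant_directional_derivative charK0 rhoX rho_p.
  rewrite !big_ord_recl big_ord0 addr0.
  by rewrite (_ : lift ord0 ord0 = i2) //; apply/val_inj.
have c0 i : c i = 0.
  apply: (simple_no_invariant_direction charK0 simpleD); apply: Ep_eq0.
    by rewrite -DX1 rho_comm rhoX D_shift.
  by rewrite -DX2 rho_comm rhoX D_shift.
apply: (simple_commuting_fixed_point simpleD rho_comm (a := fun=> 0)) => i.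
by rewrite rhoX c0 mpolyC0 addr0 mevalXU.
Qed.
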